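(* Let $\mathcal T_1=(S_1,\Sigma_1,\kappa_1)$ and $\mathcal T_2=(S_2,\Sigma_2,\kappa_2)$ be stochastic transition systems, $\alpha:(S_1,\Sigma_1)\to(S_2,\Sigma_2)$ a measurable function, and $\mu\in\mathrm{Dist}(S_1)$. If $\mathcal T_2$ is a $\mu$-sound $\alpha$-abstraction of $\mathcal T_1$, then for every $B\in\Sigma_2$: if $\mathcal T_2$ is decisive w.r.t. $B$ from $\alpha_\#(\mu)$, then $\mathcal T_1$ is decisive w.r.t. $\alpha^{-1}(B)$ from $\mu$.
   Context: A stochastic transition system (STS) is $\mathcal T=(S,\Sigma,\kappa)$ where $(S,\Sigma)$ is a measurable space and $\kappa:S\times\Sigma\to[0,1]$ is a Markov kernel. $\mathrm{Dist}(S)$ is the set of probability measures on $(S,\Sigma)$; $\delta_s$ is the Dirac measure at $s$. For $\mu\in\mathrm{Dist}(S)$, $\mathrm{Prob}^{\mathcal T}_\mu$ is the law on infinite paths $s_0s_1\dots\in S^\omega$ (cylinder $\sigma$-algebra) of the Markov chain with initial distribution $\mu$ and kernel $\kappa$. $\mathbf F B$ is the event $\exists i\ge0,\ s_i\in B$. The avoid-set of $B\in\Sigma$ is $\widetilde B=\{s\in S\mid\mathrm{Prob}^{\mathcal T}_{\delta_s}(\mathbf F B)=0\}$ (a measurable set). $\mathcal T$ is decisive w.r.t. $B$ from $\mu$ if $\mathrm{Prob}^{\mathcal T}_\mu(\mathbf F B\vee\mathbf F\widetilde B)=1$. $\Omega_{\mathcal T}(\mu)\in\mathrm{Dist}(S)$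 is defined by $\Omega_{\mathcal T}(\mu)(A)=\int_S\kappa(s,A)\,\mu(\mathrm ds)$. The pushforward $\alpha_\#:\mathrm{Dist}(S_1)\to\mathrm{Dist}(S_2)$ is $\alpha_\#(\mu)(M)=\mu(\alpha^{-1}(M))$. $\mathcal T_2$ is an $\alpha$-abstraction of $\mathcal T_1$ if for every $\mu\in\mathrm{Dist}(S_1)$ the measures $\alpha_\#(\Omega_{\mathcal T_1}(\mu))$ and $\Omega_{\mathcal T_2}(\alpha_\#(\mu))$ have the same null sets. It is $\mu$-sound if for every $B\in\Sigma_2$: $\mathrm{Prob}^{\mathcal T_2}_{\alpha_\#(\mu)}(\mathbf F B)=1$ implies $\mathrm{Prob}^{\mathcal T_1}_\mu(\mathbf F\alpha^{-1}(B))=1$. *)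

(* Defs.v *)
From HB Require Import structures.
From mathcomp Require Import all_boot all_order all_algebra.
From mathcomp Require Import all_classical all_reals all_analysis.

Set Implicit Arguments.
Unset Strict Implicit.
Unset Printing Implicit Defensive.
Import Order.TTheory GRing.Theory Num.Theory.

Local Open Scope classical_set_scope.
Local Open Scope ring_scope.
Local Open Scope ereal_scope.

(* A stochastic transition system with state space [S] is a Markov kernel from
   [S] to [S]; [Dist(S)] is [probability S R]. *)
Notation sts R S := (probability_kernel S S R).

Section paths.
Context d (S : measurableType d).

(* The cylinder [A_0 x ... x A_{n-1} x S x S x ...] for [l = [:: A_0; ...; A_{n-1}]]. *)
Definition cylinder (l : seq (set S)) : set (nat -> S) :=
  [set w | forall i, nth setT l i (w i)].

Definition cylinders : set (set (nat -> S)) :=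
  [set cylinder l | l in [set l | forall i, measurable (nth setT l i)]].

Definition infpath := g_sigma_algebraType cylinders.

Definition eventually (B : set S) : set infpath := [set w | exists i, B (w i)].

End paths.

Section sts.
Context d (S : measurableType d) (R : realType).
Implicit Types (kappa : sts R S) (mu : probability S R).

(* \int[nu]_(s0 in A_0) \int[kappa s0]_(s1 in A_1) ... 1 *)
Fixpoint cylinder_mass kappa (nu : {measure set S -> \bar R})
    (l : seq (set S)) : \bar R :=
  if l is A :: l' then \int[nu]_(s in A) cylinder_mass kappa (kappa s) l'
  else 1.

Definition is_path_law kappa mu (P : probability (infpath S) R) : Prop :=
  forall l : seq (set S), (forall i, measurable (nth setT l i)) ->
    P (cylinder l) = cylinder_mass kappa mu l.

(* [is_path_law kappa mu] has exactly one inhabitant up to equality on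
   measurable sets (Ionescu-Tulcea, without any assumption on [S]), so the
   value on measurable sets does not depend on the choice made by [get]. *)
Definition path_law kappa mu : probability (infpath S) R :=
  get (is_path_law kappa mu).

Definition avoid kappa (B : set S) : set S :=
  [set s | path_law kappa (\d_s)%R (eventually B) = 0].

Definition decisive kappa (B : set S) mu : Prop :=
  path_law kappa mu (eventually B `|` eventually (avoid kappa B)) = 1.

Definition Omega kappa mu (A : set S) : \bar R := \int[mu]_s kappa s A.

Section Omega_probability.
Variables (kappa : sts R S) (mu : probability S R).

Let Omega0 : Omega kappa mu set0 = 0.
Proof. by apply: integral0_eq => s _; rewrite measure0. Qed.

Let Omega_ge0 A : 0 <= Omega kappa mu A.
Proof. by apply: integral_ge0 => s _; exact: measure_ge0. Qed.

Let Omega_sigma_additive : semi_sigma_additive (Omega kappa mu).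
Proof.
move=> F mF tF mUF; rewrite [X in _ --> X](_ : _ =
    \int[mu]_s \sum_(0 <= n <oo) kappa s (F n)); last first.
  apply: eq_integral => s _.
  by apply/esym/cvg_lim => //; exact: measure_semi_sigma_additive.
apply/cvg_closeP; split.
  by apply: is_cvg_nneseries => n _ _; exact: Omega_ge0.
rewrite closeE// integral_nneseries// => n.
exact: measurable_kernel.
Qed.

HB.instance Definition _ := isMeasure.Build _ _ _ (Omega kappa mu)
  Omega0 Omega_ge0 Omega_sigma_additive.

Let Omega_setT : Omega kappa mu setT = 1.
Proof.
rewrite /Omega (eq_integral (cst 1)) => [|s _]; last exact: prob_kernel.
rewrite integral_cst// mul1e; exact: probability_setT.
Qed.

HB.instance Definition _ :=
  Measure_isProbability.Build _ _ _ (Omega kappa mu) Omega_setT.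

End Omega_probability.

End sts.

Section abstraction.
Context d1 d2 (S1 : measurableType d1) (S2 : measurableType d2) (R : realType).
Variables (kappa1 : sts R S1) (kappa2 : sts R S2) (alpha : {mfun S1 >-> S2}).

(* The pushforward of [mu] along [alpha] is [distribution mu alpha]. *)
Definition is_abstraction : Prop :=
  forall (mu : probability S1 R) (A : set S2), measurable A ->
    distribution (Omega kappa1 mu) alpha A = 0 <->
    Omega kappa2 (distribution mu alpha) A = 0.

Definition sound (mu : probability S1 R) : Prop :=
  forall B : set S2, measurable B ->
    path_law kappa2 (distribution mu alpha) (eventually B) = 1 ->
    path_law kappa1 mu (eventually (alpha @^-1` B)) = 1.

End abstraction.

(* Main.v *)
(* The avoid-set of B is the set of states outside every C_n, where C_0 = B and
   C_{n+1} = {s | kappa s C_n > 0}. The abstraction condition yields, by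
   induction on n and for every initial distribution nu, that nu gives mass 0 to
   the C_n of alpha^-1(B) iff its image under alpha gives mass 0 to the C_n of B;
   applied to Dirac measures, alpha^-1 commutes with avoid-sets. Decisiveness
   with respect to B is almost sure reachability of the union of B and its
   avoid-set, so it is transferred by soundness.

   Relating [path_law] to the kernel requires the Ionescu-Tulcea theorem. The
   conditional probability [cond E j w] of a finite-dimensional event E given the
   first j coordinates of w is an iterated integral, and countable subadditivity
   is obtained by following one path along which a hypothetical strict
   inequality persists at every time. *)
Require Import Defs.
From HB Require Import structures.
From mathcomp Require Import all_boot all_order all_algebra.
From mathcomp Require Import all_classical all_reals all_analysis.
From mathcomp Require Import measurable_realfun.
Import Defs.

Set Implicit Arguments.
Unset Strict Implicit.
Unset Printing Implicit Defensive.
Import Order.TTheory GRing.Theory Num.Theory.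

Local Open Scope classical_set_scope.
Local Open Scope ring_scope.
Local Open Scope ereal_scope.

(** * Measurability on path space and events determined by finitely many coordinates *)

Section infpath_measurability.
Context d (S : measurableType d).

Lemma measurable_cylinder (l : seq (set S)) :
  (forall i, measurable (nth setT l i)) ->
  measurable (cylinder l : set (infpath S)).
Proof. by move=> ml; apply: sub_sigma_algebra; exists l. Qed.

Lemma coord_cylinder n (A : set S) :
  [set w : infpath S | A (w n)] = cylinder (ncons n setT [:: A]).
Proof.
apply/seteqP; split => w /=.
  move=> Awn i; rewrite nth_ncons; case: ltngtP => [//|ni|->]; last first.
    by rewrite subnn.
  by rewrite -(subnSK ni) /= nth_nil.
by move=> /(_ n); rewrite nth_ncons ltnn subnn.
Qed.

Lemma measurable_nth_ncons n (A : set S) : measurable A ->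
  forall i, measurable (nth setT (ncons n setT [:: A]) i).
Proof.
move=> mA i; rewrite nth_ncons; case: ifP => // _.
by case: (i - n)%N => [|k] //=; rewrite nth_nil; exact: measurableT.
Qed.

Lemma measurable_coord n : measurable_fun setT (fun w : infpath S => w n).
Proof.
move=> _ A mA; rewrite setTI [X in measurable X]coord_cylinder.
apply: measurable_cylinder; exact: measurable_nth_ncons.
Qed.

Lemma eventually_bigcup (B : set S) :
  eventually B = \bigcup_n [set w : infpath S | B (w n)].
Proof.
by apply/seteqP; split=> w; [move=> [n Bwn]; exists n|move=> [n _ Bwn]; exists n].
Qed.

Lemma eventuallyU (A B : set S) :
  eventually (A `|` B) = eventually A `|` eventually B.
Proof.
apply/seteqP; split=> w.
  by move=> [n [?|?]]; [left|right]; exists n.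
by move=> [[n ?]|[n ?]]; exists n; [left|right].
Qed.

Lemma measurable_to_infpath d' (T : measurableType d') (f : T -> infpath S) :
  (forall i, measurable_fun setT (fun t => f t i)) -> measurable_fun setT f.
Proof.
move=> mf; apply: (@measurability _ _ T (infpath S) setT f (@cylinders _ S) erefl).
move=> _ [_ [l ml <-] <-]; rewrite setTI.
rewrite (_ : _ @^-1` _ = \bigcap_i ((fun t => f t i) @^-1` nth setT l i)).
  apply: bigcapT_measurable => i; rewrite -[X in measurable X]setTI.
  exact: mf.
by apply/seteqP; split => [t lt i _|t lt i]; [exact: lt|exact: (lt i Logic.I)].
Qed.

Definition upd (w : infpath S) (j : nat) (s : S) : infpath S :=
  fun i => if i == j then s else w i.

Lemma measurable_upd j :
  measurable_fun setT (fun p : infpath S * S => upd p.1 j p.2).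
Proof.
apply: measurable_to_infpath => i; rewrite /upd; case: eqP => _.
  exact: measurable_snd.
exact: (measurableT_comp (measurable_coord i) measurable_fst).
Qed.

Lemma measurable_upd2 w j : measurable_fun setT (upd w j).
Proof.
exact: (measurableT_comp (measurable_upd j) (pair1_measurable w)).
Qed.

Definition depends_below n (E : set (infpath S)) :=
  forall w w' : infpath S, (forall i, (i < n)%N -> w i = w' i) -> E w -> E w'.

Lemma depends_belowE n E w w' : depends_below n E ->
  (forall i, (i < n)%N -> w i = w' i) -> E w = E w'.
Proof.
by move=> nE ww'; apply/propext; split; apply: nE => i /ww'.
Qed.

Lemma depends_below_le m n E :
  (m <= n)%N -> depends_below m E -> depends_below n E.
Proof.
move=> mn mE w w' ww'; apply: mE => i im; apply: ww'; exact: leq_trans mn.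
Qed.

Lemma depends_belowU n A B :
  depends_below n A -> depends_below n B -> depends_below n (A `|` B).
Proof. by move=> nA nB w w' ww' [/nA|/nB] H; [left|right]; apply: H. Qed.

Lemma depends_belowC n A : depends_below n A -> depends_below n (~` A).
Proof. by move=> nA w w' ww' /= Aw; rewrite -(depends_belowE nA ww'). Qed.

(* Some admissible [n], not necessarily the least one. *)
Definition dimension (E : set (infpath S)) : nat :=
  get [set n | depends_below n E].

Lemma dimensionP n E : depends_below n E -> depends_below (dimension E) E.
Proof. by move=> nE; exact: (@getI _ [set n | depends_below n E] n nE). Qed.

(** Measurability is a separate clause: a set read off finitely many coordinates need not be
    measurable. *)
Definition finitary : set (set (infpath S)) :=
  [set E | measurable E /\ exists n, depends_below n E].

Lemma finitary0 : finitary set0.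
Proof. by split; [exact: measurable0|exists 0%N]. Qed.

Lemma finitaryU : setU_closed finitary.
Proof.
move=> A B [mA [m Am]] [mB [n Bn]]; split; first exact: measurableU.
exists (maxn m n); apply: depends_belowU.
  by apply: depends_below_le Am; exact: leq_maxl.
by apply: depends_below_le Bn; exact: leq_maxr.
Qed.

Lemma finitaryC : setC_closed finitary.
Proof.
move=> A [mA [n An]]; split; first exact: measurableC.
by exists n; exact: depends_belowC.
Qed.

(* An alias of [infpath S], to carry the algebra of finitary events. *)
Definition finpath := infpath S.

HB.instance Definition _ := Pointed.on finpath.
HB.instance Definition _ := isAlgebraOfSets.Build default_measure_display
  finpath finitary0 finitaryU finitaryC.

End infpath_measurability.

(** * Iterated integrals and conditional probabilities *)

Section averaging.
Context d (S : measurableType d) (R : realType).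
Variable K : nat -> probability_kernel (infpath S) S R.
Implicit Types (f g : infpath S -> \bar R) (w : infpath S) (E : set (infpath S)).

(* Expectation of [f] when coordinates j, ..., j + m - 1 of [w] are redrawn one
   after the other, [K i] giving the law of coordinate i; [K i] may read any
   coordinate, including those not yet redrawn. *)
Fixpoint avg m j (f : infpath S -> \bar R) (w : infpath S) : \bar R :=
  if m is m'.+1 then \int[K j w]_s avg m' j.+1 f (upd w j s) else f w.

Lemma avg_ge0 m j f w : (forall x, 0 <= f x) -> 0 <= avg m j f w.
Proof.
by elim: m j w => [|m IH] j w f0 //=; apply: integral_ge0 => s _; exact: IH.
Qed.

Lemma measurable_avg m j f : (forall x, 0 <= f x) ->
  measurable_fun setT f -> measurable_fun setT (avg m j f).
Proof.
move=> f0 mf; elim: m j => [|m IH] j //=.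
apply: (measurable_fun_integral_finite_kernel
  (fun p => avg m j.+1 f (upd p.1 j p.2)) (K j)).
  by move=> p; exact: avg_ge0.
exact: (measurableT_comp (IH j.+1) (measurable_upd j)).
Qed.

Lemma measurable_avg_upd m j f w i : (forall x, 0 <= f x) ->
  measurable_fun setT f ->
  measurable_fun setT (fun s => avg m j f (upd w i s)).
Proof.
move=> f0 mf.
exact: (measurableT_comp (measurable_avg m j f0 mf) (measurable_upd2 w i)).
Qed.

Lemma avgD m j f g w :
  (forall x, 0 <= f x) -> measurable_fun setT f ->
  (forall x, 0 <= g x) -> measurable_fun setT g ->
  avg m j (f \+ g) w = avg m j f w + avg m j g w.
Proof.
move=> f0 mf g0 mg; elim: m j w => [|m IH] j w //=.
under eq_integral do rewrite IH.
by rewrite ge0_integralD//; do ?[by move=> s _; exact: avg_ge0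
  |exact: measurable_avg_upd].
Qed.

Lemma integral_cst_kernel j w c : \int[K j w]_s (cst c s) = c.
Proof. by rewrite integral_cst//= prob_kernel mule1. Qed.

Definition charac (E : set (infpath S)) (w : infpath S) : \bar R :=
  (\1_E w)%:E.

Lemma charac_ge0 E w : 0 <= charac E w.
Proof. by rewrite lee_fin. Qed.

Lemma measurable_charac E : measurable E -> measurable_fun setT (charac E).
Proof. by move=> mE; apply/measurable_EFinP; exact: measurable_indic. Qed.

Lemma characU A B : A `&` B = set0 -> charac (A `|` B) = charac A \+ charac B.
Proof.
move=> AB0; apply/funext => w /=; rewrite /charac !indicE in_setU -EFinD.
have [Aw|] /= := boolP (w \in A); last by rewrite add0r.
have [Bw|] /= := boolP (w \in B); last by rewrite addr0.
by have : (A `&` B) w; [split; exact: set_mem|rewrite AB0].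
Qed.

Lemma charac_eq E E' w w' : E w = E' w' -> charac E w = charac E' w'.
Proof.
move=> Eww'; rewrite /charac !indicE.
by have -> : (w \in E) = (w' \in E') by apply: asbool_equiv_eq; rewrite /= Eww'.
Qed.

(** Averaging from [j] on never alters the coordinates below [j], so only paths agreeing with [w]
    there are evaluated. *)
Lemma avg_eq m j f g w :
  (forall x : infpath S, (forall i, (i < j)%N -> x i = w i) -> f x = g x) ->
  avg m j f w = avg m j g w.
Proof.
elim: m j w => [|m IH] j w fg /=; first exact: fg.
apply: eq_integral => s _; apply: IH => x xw; apply: fg => i ij.
by rewrite xw ?leqW// /upd ltn_eqF.
Qed.

Lemma avg_cst m j c w : avg m j (cst c) w = c.
Proof.
elim: m j w => [|m IH] j w //=.
by under eq_integral do rewrite IH; rewrite integral_cst_kernel.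
Qed.

Lemma avg_depends m n j E w : depends_below n E -> (n <= j)%N ->
  avg m j (charac E) w = charac E w.
Proof.
move=> nE nj; rewrite -[RHS](avg_cst m j _ w); apply: avg_eq => x xw.
by apply/charac_eq/(depends_belowE nE) => i ni; apply: xw; exact: leq_trans nj.
Qed.

Lemma avg_add m m' j f w :
  avg (m + m') j f w = avg m j (avg m' (m + j) f) w.
Proof.
elim: m j w => [|m IH] j w //=.
by apply: eq_integral => s _; rewrite IH addnS.
Qed.

(** By time [dimension E] the event is settled; truncated subtraction leaves no redraw when [j] is
    already past it. *)
Definition cond E j w : \bar R := avg (dimension E - j) j (charac E) w.

Lemma condE m n j E w : depends_below n E -> (n <= m + j)%N ->
  avg m j (charac E) w = cond E j w.
Proof.
(* Whichever of the two numbers of redraws is larger, its surplus concerns coordinates on which [E]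
   no longer depends. *)
wlog : m n j w / (m <= dimension E - j)%N => [H nE nmj|].
  have [mE|Em] := leqP m (dimension E - j)%N; first exact: (H m n).
  rewrite /cond -(subnKC (ltnW Em)) avg_add; apply: avg_eq => x _.
  by apply: (avg_depends _ _ (dimensionP nE)); rewrite addnC -leq_subLR.
move=> mE nE nmj; rewrite /cond -(subnKC mE) avg_add; apply: avg_eq => x _.
by rewrite (avg_depends _ _ nE).
Qed.

Lemma cond_ge0 E j w : 0 <= cond E j w.
Proof. by apply: avg_ge0; exact: charac_ge0. Qed.

Lemma cond_depends n j E w : depends_below n E -> (n <= j)%N ->
  cond E j w = charac E w.
Proof. by move=> nE nj; rewrite -(@condE 0 n). Qed.

Lemma cond_step E j w : finitary E ->
  cond E j w = \int[K j w]_s cond E j.+1 (upd w j s).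
Proof.
move=> [_ [n nE]].
(* Tower property: [n.+1] redraws expose a first integral even when [n = 0], and the other [n]
   suffice from time [j.+1]. *)
rewrite -(@condE n.+1 n)//=; last by rewrite (leq_trans (leqnSn _))// leq_addr.
by apply: eq_integral => s _; rewrite -(@condE n n)// leq_addr.
Qed.

Lemma measurable_cond_upd E j w i : finitary E ->
  measurable_fun setT (fun s => cond E j (upd w i s)).
Proof.
move=> [mE _]; apply: measurable_avg_upd; first exact: charac_ge0.
exact: measurable_charac.
Qed.

Lemma cond0 j w : cond set0 j w = 0.
Proof.
by rewrite (@cond_depends 0)// /charac indic0.
Qed.

Lemma condU A B j w : finitary A -> finitary B -> A `&` B = set0 ->
  cond (A `|` B) j w = cond A j w + cond B j w.
Proof.
move=> [mA [m Am]] [mB [n Bn]] AB0.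
have Am' := depends_below_le (leq_maxl m n) Am.
have Bn' := depends_below_le (leq_maxr m n) Bn.
have cE E : depends_below (maxn m n) E ->
    cond E j w = avg (maxn m n) j (charac E) w.
  by move=> nE; rewrite (condE _ nE)// leq_addr.
rewrite (cE _ Am') (cE _ Bn') (cE _ (depends_belowU Am' Bn')).
rewrite characU// avgD//; do ?[by move=> ?; exact: charac_ge0
  |exact: measurable_charac].
Qed.

Section subadditivity.
Variables (E : set (infpath S)) (F : nat -> set (infpath S)).
Hypotheses (finE : finitary E) (finF : forall k, finitary (F k)).

Let gap j w := \sum_(k <oo) cond (F k) j w < cond E j w.

(** Were the gap closed for every [s], integrating the reverse inequality against [K j w], with sum
    and integral exchanged, would close it at [w]. *)
Let gap_step j w : gap j w -> exists s, gap j.+1 (upd w j s).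
Proof.
move=> gjw; apply: contrapT => /forallNP ngap.
move: gjw; apply/negP; rewrite -leNgt cond_step//.
under eq_eseriesr do rewrite cond_step//.
rewrite -integral_nneseries//; last 2 first.
- by move=> k; exact: measurable_cond_upd.
- by move=> k s _; exact: cond_ge0.
apply: ge0_le_integral => //.
- by move=> s _; exact: cond_ge0.
- exact: measurable_cond_upd.
- apply: ge0_emeasurable_sum => [k x|k] _; first by move=> _; exact: cond_ge0.
  exact: measurable_cond_upd.
- by move=> s _; rewrite leNgt; apply/negP/ngap.
Qed.

(* A gap at the root propagates along a single path, which lies in [E] but in
   no [F k]. *)
Lemma cond_sigma_subadditive w : E `<=` \bigcup_k F k ->
  cond E 0 w <= \sum_(k <oo) cond (F k) 0 w.
Proof.
move=> EF; rewrite leNgt; apply/negP => gap0.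
pose next j v := upd v j (get [set s | gap j.+1 (upd v j s)]).
pose v := fix v j := if j is j'.+1 then next j' (v j') else w.
have gapv j : gap j (v j).
  elim: j => //= j /gap_step[s gs].
  exact: (@getI _ [set s | gap j.+1 (upd (v j) j s)] s gs).
(* Diagonal path: coordinate [i] is written in passing from [v i] to [v i.+1] and never touched
   again. *)
pose x : infpath S := fun i => v i.+1 i.
have vx j i : (i < j)%N -> v j i = x i.
  elim: j => //= j IH; rewrite ltnS leq_eqVlt => /predU1P[->//|ij].
  by rewrite /next {1}/upd ltn_eqF// IH.
have condx n A j : depends_below n A -> (n <= j)%N ->
    cond A j (v j) = charac A x.
  move=> nA nj; rewrite (cond_depends _ nA nj).
  apply/charac_eq/(depends_belowE nA) => i ni; apply: vx.
  exact: leq_trans nj.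
have [_ [n nE]] := finE.
have Ex : E x.
  (* If [x] misses [E], then [cond E n (v n)] is 0 and cannot exceed a sum of nonnegative terms. *)
  apply: contrapT => nEx; move: (gapv n); apply/negP; rewrite -leNgt.
  rewrite (condx n)// /charac indicE memNset//.
  by apply: nneseries_ge0 => k _ _; exact: cond_ge0.
have [k _ Fkx] := EF _ Ex.
have [_ [m mF]] := finF k.
(* At time [maxn m n] both events are settled, so the [k]-th term alone already equals the value for
   [E], namely 1. *)
move: (gapv (maxn m n)); apply/negP; rewrite -leNgt.
rewrite (condx n) ?leq_maxr// /charac indicE mem_set//.
rewrite (@nneseriesD1 _ _ k)//; last by move=> *; exact: cond_ge0.
rewrite (condx m (F k)) ?leq_maxl// /charac indicE mem_set//.
by rewrite leeDl//; apply: nneseries_ge0 => i _ _; exact: cond_ge0.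
Qed.

End subadditivity.

End averaging.

(** * Carathéodory extension to a trajectory law *)

Section ionescu_tulcea.
Context d (S : measurableType d) (R : realType).
Variables (K : nat -> probability_kernel (infpath S) S R) (w0 : infpath S).

(** The base path [w0] supplies the coordinates that the kernels may read before they are
    redrawn. *)
Definition premass (E : set (finpath S)) : \bar R := cond K E 0 w0.

Let premass_ge0 E : 0 <= premass E. Proof. exact: cond_ge0. Qed.

Let premass_additive : measure_function.semi_additive premass.
Proof.
apply/additive2P; first exact: cond0.
by move=> A B mA mB AB0; exact: condU.
Qed.

HB.instance Definition _ := isContent.Build _ (finpath S) R premass
  premass_ge0 premass_additive.

Let premass_sigma_subadditive : measurable_subset_sigma_subadditive premass.
Proof. by move=> E F mF mE EF; exact: cond_sigma_subadditive. Qed.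

HB.instance Definition _ := Content_SigmaSubAdditive_isMeasure.Build _ R
  (finpath S) premass premass_sigma_subadditive.

Let finalg := g_sigma_algebraType (@measurable _ (finpath S)).

Lemma depends_below_cylinder (l : seq (set S)) :
  depends_below (size l) (cylinder l).
Proof.
move=> w w' ww' lw i; have [il|li] := ltnP i (size l).
  by rewrite -ww'.
by rewrite nth_default.
Qed.

(** Cylinders are finitary, so the extension, which lives on the sigma-algebra generated by finitary
    events, measures every measurable set of paths. *)
Let measurable_finalg (E : set (infpath S)) :
  measurable E -> measurable (E : set finalg).
Proof.
apply: smallest_sub; first exact: smallest_sigma_algebra.
move=> _ [l ml <-]; apply: sub_sigma_algebra.
split; first exact: measurable_cylinder.
by exists (size l); exact: depends_below_cylinder.
Qed.

Definition traj_law (E : set (infpath S)) : \bar R :=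
  measure_extension premass (E : set finalg).

Let traj_law0 : traj_law set0 = 0. Proof. exact: measure0. Qed.

Let traj_law_ge0 E : 0 <= traj_law E. Proof. exact: measure_ge0. Qed.

Let traj_law_sigma_additive : semi_sigma_additive traj_law.
Proof.
move=> F mF tF mUF.
apply: (@measure_semi_sigma_additive _ finalg R (measure_extension premass)) => //.
  by move=> i; exact: measurable_finalg.
exact: measurable_finalg.
Qed.

HB.instance Definition _ := isMeasure.Build _ (infpath S) R traj_law
  traj_law0 traj_law_ge0 traj_law_sigma_additive.

Lemma traj_lawE E : finitary E -> traj_law E = cond K E 0 w0.
Proof. by move=> finE; exact: measurable_mu_extE. Qed.

Let traj_law_setT : traj_law setT = 1.
Proof.
rewrite traj_lawE; last exact: (@measurableT _ (finpath S)).
rewrite (@cond_depends _ _ _ _ 0)//.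
by rewrite /charac indicT.
Qed.

HB.instance Definition _ :=
  Measure_isProbability.Build _ _ _ traj_law traj_law_setT.

End ionescu_tulcea.

(** * The path law of a Markov chain *)

Section path_law_exists.
Context d (S : measurableType d) (R : realType).
Variables (kappa : sts R S) (mu : probability S R).

(** Initial distribution and transition kernel are merged into one family, to serve as the [K] of
    the general construction. *)
Definition next_law (n : nat) (w : infpath S) : {measure set S -> \bar R} :=
  if n is n'.+1 then kappa (w n') else mu.

Let measurable_next_law n U :
  measurable U -> measurable_fun [set: infpath S] (next_law n ^~ U).
Proof.
case: n => [|n] mU /=; first exact: measurable_cst.
exact: (measurableT_comp (measurable_kernel kappa U mU) (measurable_coord n)).
Qed.

HB.instance Definition _ n :=
  isKernel.Build _ _ (infpath S) S R (next_law n) (measurable_next_law n).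

Let next_law_setT n w : next_law n w setT = 1.
Proof. by case: n => [|n] /=; [exact: probability_setT|exact: prob_kernel]. Qed.

HB.instance Definition _ n :=
  Kernel_isProbability.Build _ _ (infpath S) S R (next_law n) (next_law_setT n).

(** The starting time [j] is arbitrary because, in the induction on [l], it advances with each
    redraw. *)
Let shifted_cylinder j (l : seq (set S)) : set (infpath S) :=
  [set w | forall i, nth setT l i (w (j + i)%N)].

Let avg_cylinder (l : seq (set S)) j w :
  avg next_law (size l) j (charac R (shifted_cylinder j l)) w =
  cylinder_mass kappa (next_law j w) l.
Proof.
elim: l j w => [|A l IH] j w /=.
  rewrite /charac indicE mem_set// => i.
  by rewrite nth_nil.
rewrite [RHS]integral_mkcond; apply: eq_integral => s _.
rewrite patchE; case: ifPn => sA.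
  have -> : kappa s = next_law j.+1 (upd w j s) by rewrite /= /upd eqxx.
  rewrite -IH; apply: avg_eq => x xw; apply: charac_eq; apply/propext.
  have xj : x j = s by rewrite xw// /upd eqxx.
  split=> [H i|H [|i]] /=.
  - by have := H i.+1; rewrite addnS addSn.
  - by rewrite addn0 xj; exact: set_mem.
  - by have := H i; rewrite addnS addSn.
(* For [s] outside [A] no later redraw can bring the path back into the cylinder, so the average is
   that of the constant 0. *)
rewrite -[RHS](avg_cst next_law (size l) j.+1 0 (upd w j s)).
apply: avg_eq => x xw; have xj : x j = s by rewrite xw// /upd eqxx.
rewrite /charac indicE memNset// => /(_ 0%N) /=.
by rewrite addn0 xj => As; move/negP: sA; apply; exact: mem_set.
Qed.

Lemma is_path_law_path_law : is_path_law kappa mu (path_law kappa mu).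
Proof.
(* [next_law] never reads a coordinate before it is drawn, so any base path, here [point], will
   do. *)
apply: getPex; exists (traj_law next_law point : probability (infpath S) R) => l ml.
have dl := @depends_below_cylinder _ _ l.
have fl : finitary (cylinder l).
  by split; [exact: measurable_cylinder|exists (size l)].
rewrite [LHS](traj_lawE next_law point fl).
by rewrite -(@condE _ _ _ _ (size l) (size l)) ?leq_addr.
Qed.

End path_law_exists.

(** * Null integrals, null reachability events and avoid-sets *)

Lemma integral_eq0P d (T : measurableType d) (R : realType)
    (nu : {measure set T -> \bar R}) (g : T -> \bar R) :
  (forall x, 0 <= g x) -> measurable_fun setT g ->
  \int[nu]_x g x = 0 <-> nu [set x | g x != 0] = 0.
Proof.
move=> g0 mg.
have mN : measurable [set x | g x != 0].
  by rewrite -[X in measurable X]setTI; exact: emeasurable_fun_neq.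
rewrite -(negligibleP _ mN).
rewrite (eq_integral (fun x => `|g x|)); last by move=> x _; rewrite gee0_abs.
rewrite ae_eq_integral_abs//.
split; apply: negligibleS => x /=.
  by move=> gx0 H; move/eqP: gx0; apply; exact: H.
by move/not_implyP => [_ /eqP].
Qed.

Lemma dirac_eq0 d (T : measurableType d) (R : realType) (t : T) (A : set T) :
  \d_t A = 0 :> \bar R <-> ~ A t.
Proof.
rewrite diracE; split=> [|nA]; last by rewrite memNset.
by move=> + At; rewrite mem_set// => -[] /eqP; rewrite oner_eq0.
Qed.

Section charging.
Context d (S : measurableType d) (R : realType).
Variable kappa : sts R S.

(* The states from which [B] has positive probability of being hit at time
   exactly [n]. *)
Fixpoint charging (B : set S) n : set S :=
  if n is n'.+1 then [set s | kappa s (charging B n') != 0] else B.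

Lemma measurable_charging B n : measurable B -> measurable (charging B n).
Proof.
move=> mB; elim: n => //= n IH.
rewrite -[X in measurable X]setTI; apply: emeasurable_fun_neq => //.
exact: measurable_kernel.
Qed.

Lemma cylinder_mass_ge0 (nu : {measure set S -> \bar R}) l :
  0 <= cylinder_mass kappa nu l.
Proof.
by elim: l nu => [|A l IH] nu //=; apply: integral_ge0 => s _; exact: IH.
Qed.

Lemma measurable_cylinder_mass l : (forall i, measurable (nth setT l i)) ->
  measurable_fun setT (fun s => cylinder_mass kappa (kappa s) l).
Proof.
elim: l => [|A l IH] ml //=.
under eq_fun do rewrite integral_mkcond.
apply: measurable_fun_integral_kernel.
- by move=> U mU; exact: measurable_kernel.
- by move=> s; apply: erestrict_ge0 => t _; exact: cylinder_mass_ge0.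
- apply/(measurable_restrictT _ (ml 0%N)); apply: measurable_funTS.
  by apply: IH => i; exact: (ml i.+1).
Qed.

(** Induction for all [nu]: a nonnegative integral vanishes iff its integrand does almost
    everywhere, and by induction at [kappa s] the integrand is nonzero exactly on
    [charging B n.+1]. *)
Lemma cylinder_mass_charging B n (nu : {measure set S -> \bar R}) :
  measurable B ->
  cylinder_mass kappa nu (ncons n setT [:: B]) = 0 <-> nu (charging B n) = 0.
Proof.
move=> mB; elim: n nu => [|n IH] nu /=.
  by rewrite integral_cst// mul1e.
rewrite integral_eq0P; last 2 first.
- by move=> s; exact: cylinder_mass_ge0.
- by apply: measurable_cylinder_mass; exact: measurable_nth_ncons.
rewrite (_ : [set s | _] = [set s | kappa s (charging B n) != 0])//.
by apply/seteqP; split=> s /= /eqP H; apply/eqP => /IH.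
Qed.

Lemma path_law_eventually_eq0 (nu : probability S R) B : measurable B ->
  path_law kappa nu (eventually B) = 0 <-> forall n, nu (charging B n) = 0.
Proof.
move=> mB; have mC n : measurable [set w : infpath S | B (w n)].
  by rewrite coord_cylinder; apply: measurable_cylinder; exact: measurable_nth_ncons.
have PC n : path_law kappa nu [set w : infpath S | B (w n)] = 0 <->
    nu (charging B n) = 0.
  rewrite -cylinder_mass_charging// coord_cylinder is_path_law_path_law//.
  exact: measurable_nth_ncons.
rewrite eventually_bigcup; split=> [P0 n|nu0].
  apply/PC; apply: subset_measure0 P0 => //; first exact: bigcup_measurable.
  by move=> w Bwn; exists n.
apply/negligibleP; first exact: bigcup_measurable.
by apply: negligible_bigcup => n; apply/negligibleP => //; exact/PC.
Qed.

(** At the Dirac measure of [s], nullity of [charging B n] means that [s] lies outside it. *)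
Lemma avoidE B : measurable B -> avoid kappa B = \bigcap_n ~` charging B n.
Proof.
move=> mB; apply/seteqP; split=> s /=.
  by move=> /(path_law_eventually_eq0 _ mB) H n _; exact/(dirac_eq0 R)/H.
move=> H; apply/(path_law_eventually_eq0 _ mB) => n.
exact/(dirac_eq0 R)/H.
Qed.

Lemma measurable_avoid B : measurable B -> measurable (avoid kappa B).
Proof.
move=> mB; rewrite avoidE//; apply: bigcapT_measurable => n.
by apply: measurableC; exact: measurable_charging.
Qed.

Lemma Omega_eq0 (nu : probability S R) A : measurable A ->
  Omega kappa nu A = 0 <-> nu [set s | kappa s A != 0] = 0.
Proof. by move=> mA; apply: integral_eq0P => //; exact: measurable_kernel. Qed.

End charging.

(** * Transfer along the abstraction *)

Section abstraction.
Context d1 d2 (S1 : measurableType d1) (S2 : measurableType d2) (R : realType).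
Variables (kappa1 : sts R S1) (kappa2 : sts R S2) (alpha : {mfun S1 >-> S2}).
Hypothesis abs12 : is_abstraction kappa1 kappa2 alpha.

(** Stated for all [nu] because the induction hypothesis is used at [Omega kappa1 nu]: going from
    [n.+1] back to [n] replaces [nu] by its one-step image, where [abs12] compares the two
    systems. *)
Lemma charging_abstraction (nu : probability S1 R) B n : measurable B ->
  nu (charging kappa1 (alpha @^-1` B) n) = 0 <->
  nu (alpha @^-1` charging kappa2 B n) = 0.
Proof.
move=> mB; elim: n nu => [|n IH] nu //=.
have mA : measurable (alpha @^-1` B) by exact: measurable_funPTI.
have mC2 := measurable_charging kappa2 n mB.
rewrite -(Omega_eq0 kappa1 nu (measurable_charging kappa1 n mA)).
rewrite (IH (Omega kappa1 nu)) (abs12 nu mC2).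
exact: (Omega_eq0 kappa2 (distribution nu alpha)).
Qed.

Lemma preimage_avoid B : measurable B ->
  alpha @^-1` avoid kappa2 B = avoid kappa1 (alpha @^-1` B).
Proof.
move=> mB; rewrite !avoidE//; last exact: measurable_funPTI.
rewrite preimage_bigcap; apply: eq_bigcapr => n _.
have C12 s := charging_abstraction \d_s n mB.
by apply/seteqP; split=> s /= /(dirac_eq0 R) /(C12 s) /(dirac_eq0 R).
Qed.

End abstraction.

Theorem proposition33 (R : realType) (d1 d2 : measure_display)
    (S1 : measurableType d1) (S2 : measurableType d2)
    (kappa1 : sts R S1) (kappa2 : sts R S2)
    (alpha : {mfun S1 >-> S2}) (mu : probability S1 R)
    (Habs : is_abstraction kappa1 kappa2 alpha)
    (Hsound : sound kappa1 kappa2 alpha mu)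
    (B : set S2) (mB : measurable B)
    (Hdec : decisive kappa2 B (distribution mu alpha)) :
  decisive kappa1 (alpha @^-1` B) mu.
Proof.
(* The goal becomes reachability of the preimage of one set, [B] joined with its avoid-set; [Hsound]
   applies once that union is measurable. *)
rewrite /decisive -(preimage_avoid Habs mB) -eventuallyU -preimage_setU.
apply: Hsound; last by rewrite eventuallyU.
by apply: measurableU => //; exact: measurable_avoid.
Qed.
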